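(* Let $\Gamma$ be a finite thick linear space such that the triangle complex $\Delta(\Gamma)$ is a geometry. Then $\Delta(\Gamma)$ is flag-transitive if and only if $\mathrm{Aut}(\Gamma)$ acts transitively on the set $T(\Gamma)$ of ordered triples of non-collinear points of $\Gamma$.
   Context: A linear space is a rank two geometry of points and lines in which every line has at least two points, every point is on at least two lines, and any two distinct points lie on exactly one common line; it is thick if every line has at least three points and every point is on at least three lines. Triangle complex: $\Delta(\Gamma)$ is the rank three incidence system over $\{1,2,3\}$ whose elements are the triples $(p,L,i)$ with $p$ incident with $L$ and $i\in\{1,2,3\}$; the type of $(p,L,i)$ is $i$; and $(p,L,i)$ is incident with $(p',L',i \bmod 3+1)$ if and only if the set of points incident with both $L$ and $L'$ is exactly $\{p\}$ and $p\neq p'$ (incidence symmetric and reflexive, no other incidences). A geometry is an incidence system in which every maximal set of pairwise incident elements (flag) contains an element of each type (a chamber); it is flag-transitive if its type-preserving automorphism group is transitive on chambers. *)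

(* Defs.v *)
From HB Require Import structures.
From mathcomp Require Import all_boot all_fingroup all_solvable.

Set Implicit Arguments.
Unset Strict Implicit.
Unset Printing Implicit Defensive.

(** Finite incidence systems and geometries over a type set [I] *)

Record incidence_system (I : finType) := IncidenceSystem {
  elt :> finType;
  typ : elt -> I;
  inc : rel elt;
  inc_refl : reflexive inc;
  inc_sym : symmetric inc;
  inc_typ : forall x y, inc x y -> typ x = typ y -> x = y
}.

Section Geometry.

Variables (I : finType) (X : incidence_system I).
Implicit Type F : {set X}.

Definition flag F := [forall x in F, forall y in F, inc x y].

Definition chamber F := flag F && [forall i, exists x in F, typ x == i].

Definition geometry := forall F, maxset flag F -> chamber F.

(* Type-preserving automorphisms only: correlations (e.g. dualities of a
   projective plane) are excluded. *)
Definition type_aut : {set {perm X}} :=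
  [set g : {perm X} | [forall x, typ (g x) == typ x] &
           [forall x, forall y, inc (g x) (g y) == inc x y]].

Lemma type_aut_group_set : group_set type_aut.
Proof.
apply/group_setP; split=> [|g h].
  rewrite inE; apply/andP; split; apply/forallP=> x; first by rewrite perm1.
  by apply/forallP=> y; rewrite !perm1.
rewrite !inE => /andP[/forallP tg /forallP ig] /andP[/forallP th /forallP ih].
apply/andP; split; apply/forallP=> x.
  by rewrite permM (eqP (th _)) tg.
apply/forallP=> y; rewrite !permM.
by rewrite (eqP (forallP (ih _) _)) (forallP (ig _)).
Qed.

Canonical type_aut_group := Group type_aut_group_set.

Definition flag_transitive :=
  [transitive type_aut, on [set C | chamber C] | 'P^*].

End Geometry.

(** Linear spaces, as rank two geometries of points and lines *)

Variant pl_type := Point | Line.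

Definition bool_of_pl t := if t is Point then true else false.
Definition pl_of_bool (b : bool) := if b then Point else Line.
Lemma bool_of_plK : cancel bool_of_pl pl_of_bool. Proof. by case. Qed.

HB.instance Definition _ := Finite.copy pl_type (can_type bool_of_plK).

Section LinearSpace.

Variable G : incidence_system pl_type.
Implicit Types p q L : G.

Definition points_on L : {set G} := [set p | typ p == Point & inc p L].
Definition lines_on p : {set G} := [set L | typ L == Line & inc p L].

Definition linear_space :=
  [/\ geometry G,
      forall L, typ L = Line -> 2 <= #|points_on L|,
      forall p, typ p = Point -> 2 <= #|lines_on p|
    & forall p q, typ p = Point -> typ q = Point -> p != q ->
        exists! L, L \in lines_on p :&: lines_on q].

Definition thick :=
  (forall L, typ L = Line -> 3 <= #|points_on L|) /\
  (forall p, typ p = Point -> 3 <= #|lines_on p|).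

Definition noncollinear_triples : {set 3.-tuple G} :=
  [set t : 3.-tuple G | [forall i, typ (tnth t i) == Point] &
           ~~ [exists L, (typ L == Line) && [forall i, inc (tnth t i) L]]].

(* The types 1, 2, 3 of the triangle complex are 0, 1, 2 : 'I_3, so that
   i |-> i mod 3 + 1 is the cyclic successor ordS. *)
Definition triangle_elt :=
  {x : G * G * 'I_3 |
    [&& typ x.1.1 == Point, typ x.1.2 == Line & inc x.1.1 x.1.2]}.

Definition tpoint (x : triangle_elt) : G := (val x).1.1.
Definition tline (x : triangle_elt) : G := (val x).1.2.
Definition ttype (x : triangle_elt) : 'I_3 := (val x).2.

Definition triangle_step : rel triangle_elt := fun x y =>
  [&& ttype y == ordS (ttype x),
      points_on (tline x) :&: points_on (tline y) == [set tpoint x]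
    & tpoint x != tpoint y].

Definition triangle_inc : rel triangle_elt := fun x y =>
  [|| x == y, triangle_step x y | triangle_step y x].

Lemma triangle_inc_refl : reflexive triangle_inc.
Proof. by move=> x; rewrite /triangle_inc eqxx. Qed.

Lemma triangle_inc_sym : symmetric triangle_inc.
Proof. by move=> x y; rewrite /triangle_inc eq_sym; congr (_ || _); rewrite orbC. Qed.

Lemma triangle_inc_typ x y : triangle_inc x y -> ttype x = ttype y -> x = y.
Proof.
have ordS_neq (i : 'I_3) : (i == ordS i) = false by case: i => -[|[|[]]].
by rewrite /triangle_inc /triangle_step => + Exy; rewrite Exy ordS_neq !orbF => /eqP.
Qed.

Definition triangle_complex : incidence_system 'I_3 :=
  IncidenceSystem triangle_inc_refl triangle_inc_sym triangle_inc_typ.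

End LinearSpace.

(* Main.v *)
(** Chambers of the triangle complex correspond to triangles: the points of the
elements of types 1, 2, 3 of a chamber form a non-collinear triple, which
determines the chamber.  Automorphisms of the linear space act compatibly on
both sides, so what must be shown is that, under flag-transitivity, every
type-preserving automorphism of the complex comes from the linear space.

Flag-transitivity makes all lines of the same size k, because (p, L, i) has
v - |L| neighbours of type i + 1.  Two elements of type i with the same point
have at least k - 1 common neighbours of type i + 1, and with different points
at most k - 2; so automorphisms preserve equality of points among elements of
one type.  Hence all points lie on the same number r of lines, and the dual
count (at least r - 1 against at most r - 2 common neighbours of type i - 1)
shows that equality of lines is preserved as well.  Finally the permutations
of points and lines obtained from the three types agree, because a line is
determined by two of its points. *)

Require Import Defs.
From mathcomp Require Import all_boot all_fingroup all_solvable.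

Set Implicit Arguments.
Unset Strict Implicit.
Unset Printing Implicit Defensive.

(** * Cyclic arithmetic on three types; generic facts on finite sets and actions *)

Lemma ordS3_neq (i : 'I_3) : (ordS i == i) = false.
Proof. by case: i => -[|[|[]]]. Qed.

Lemma ordSS3_neq (i : 'I_3) : (i == ordS (ordS i)) = false.
Proof. by case: i => -[|[|[]]]. Qed.

Lemma ordSSS3 (i : 'I_3) : ordS (ordS (ordS i)) = i.
Proof. by apply/val_inj; case: i => -[|[|[]]]. Qed.

Lemma ord3_cases (i j : 'I_3) : [\/ j = i, j = ordS i | j = ordS (ordS i)].
Proof.
case: i j => -[|[|[|//]]] ? [] [|[|[|//]]] ?.
all: by [apply: Or31; apply: val_inj | apply: Or32; apply: val_inj
        | apply: Or33; apply: val_inj].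
Qed.

Lemma card_gt_ex (T : finType) (s : seq T) (A : {set T}) :
  size s < #|A| -> exists2 x, x \in A & x \notin s.
Proof.
move=> ltsA; have /subsetPn[x Ax sx] : ~~ (A \subset s).
  apply: contraL ltsA => /subset_leq_card leA.
  by rewrite -leqNgt (leq_trans leA) // card_size.
by exists x.
Qed.

Lemma type_autP (I : finType) (X : incidence_system I) (g : {perm X}) :
  reflect ((forall x, typ (g x) = typ x) /\
           forall x y, inc (g x) (g y) = inc x y)
          (g \in type_aut X).
Proof.
rewrite inE; apply: (iffP andP) => [[/forallP tg /forallP ig] | [tg ig]].
  by split=> [x|x y]; [exact/eqP/tg | exact/eqP/(forallP (ig x))].
split; apply/forallP => x; first by rewrite tg.
by apply/forallP => y; rewrite ig.
Qed.

Lemma atransI (aT : finGroupType) (T : finType) (to : {action aT &-> T})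
    (A : {set aT}) (S : {set T}) (x : T) :
  x \in S -> {in A, forall a, to x a \in S} ->
  {in S, forall y : T, exists2 a, a \in A & y = to x a} ->
  [transitive A, on S | to].
Proof.
move=> Sx actA trA; apply/imsetP; exists x => //; apply/setP=> y.
apply/idP/orbitP => [/trA[a Aa ->] | [a Aa <-]]; last exact: actA.
by exists a.
Qed.

(** * Elements of the triangle complex and the directed relation between consecutive types *)

Section ThickLinearSpace.

Variable G : incidence_system pl_type.
Hypotheses (linG : linear_space G) (thickG : thick G).

Local Notation D := (triangle_complex G).
Implicit Types (x y z : triangle_elt G) (p q L M : G) (i j : 'I_3).

Lemma tpoint_typ x : typ (tpoint x) = Point.
Proof. by case/and3P: (valP x) => /eqP. Qed.

Lemma tline_typ x : typ (tline x) = Line.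
Proof. by case/and3P: (valP x) => _ /eqP. Qed.

Lemma inc_tpoint_tline x : inc (tpoint x) (tline x).
Proof. by case/and3P: (valP x). Qed.

Lemma triangle_elt_eq x y :
  tpoint x = tpoint y -> tline x = tline y -> ttype x = ttype y -> x = y.
Proof.
case: x y => [[[p L] i] px] [[[q M] j] py]; rewrite /tpoint /tline /ttype /=.
by move=> ? ? ?; apply: val_inj; congr (_, _, _).
Qed.

Lemma triangle_elt_ex p L i : typ p = Point -> typ L = Line -> inc p L ->
  exists x, [/\ tpoint x = p, tline x = L & ttype x = i].
Proof.
move=> tp tL pL.
have pf : [&& typ (p, L, i).1.1 == Point, typ (p, L, i).1.2 == Line
            & inc (p, L, i).1.1 (p, L, i).1.2] by rewrite /= tp tL pL !eqxx.
by exists (Sub (p, L, i) pf).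
Qed.

Lemma in_points_on p L : p \in points_on L = (typ p == Point) && inc p L.
Proof. by rewrite inE. Qed.

Lemma in_lines_on p L : L \in lines_on p = (typ L == Line) && inc p L.
Proof. by rewrite inE. Qed.

Lemma line_uniq p q L M : typ p = Point -> typ q = Point -> p != q ->
  typ L = Line -> typ M = Line ->
  inc p L -> inc q L -> inc p M -> inc q M -> L = M.
Proof.
move=> tp tq npq tL tM pL qL pM qM.
have [_ _ _ /(_ p q tp tq npq)[N [_ N_uniq]]] := linG.
by rewrite -(N_uniq L) ?(N_uniq M) // inE !in_lines_on ?tL ?tM ?pL ?qL ?pM ?qM.
Qed.

Lemma line_through p q : typ p = Point -> typ q = Point -> p != q ->
  exists L, [/\ typ L = Line, inc p L & inc q L].
Proof.
move=> tp tq npq; have [_ _ _ /(_ p q tp tq npq)[L [+ _]]] := linG.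
by rewrite inE !in_lines_on => /andP[/andP[/eqP tL pL] /andP[_ qL]]; exists L.
Qed.

(** Thickness guarantees three lines on a point, hence room to avoid any two. *)
Lemma line_avoiding p (s : seq G) : size s < 3 -> typ p = Point ->
  exists L, [/\ typ L = Line, inc p L & L \notin s].
Proof.
move=> s3 tp; have [_ /(_ p tp) p3] := thickG.
have [L] := card_gt_ex (leq_trans s3 p3).
by rewrite in_lines_on => /andP[/eqP tL pL] ?; exists L.
Qed.

Lemma point_avoiding L (s : seq G) : size s < 3 -> typ L = Line ->
  exists p, [/\ typ p = Point, inc p L & p \notin s].
Proof.
move=> s3 tL; have [/(_ L tL) L3 _] := thickG.
have [p] := card_gt_ex (leq_trans s3 L3).
by rewrite in_points_on => /andP[/eqP tp pL] ?; exists p.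
Qed.

(** Distinct lines share at most one point, so a point on both is the whole intersection. Equal
    lines would share [tpoint y] as well. *)
Lemma triangle_stepE x y : triangle_step x y =
  [&& ttype y == ordS (ttype x), inc (tpoint x) (tline y),
      tline x != tline y & tpoint x != tpoint y].
Proof.
rewrite /triangle_step; congr (_ && _).
have [-> | npq] := eqVneq (tpoint x) (tpoint y); first by rewrite !andbF.
rewrite !andbT; apply/eqP/andP => [Exy | [pM nLM]].
  have : tpoint x \in points_on (tline x) :&: points_on (tline y).
    by rewrite Exy set11.
  rewrite inE !in_points_on => /andP[_ /andP[_ pM]]; split=> //.
  apply: contra_neq npq => eqLM; apply/esym/set1P.
  by rewrite -Exy eqLM setIid in_points_on tpoint_typ eqxx inc_tpoint_tline.
apply/setP=> q; rewrite !inE; apply/andP/eqP=> [[]|->]; last first.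
  by rewrite tpoint_typ eqxx inc_tpoint_tline.
move=> /andP[/eqP tq qL] /andP[_ qM]; apply: contra_neq_eq nLM => nqp.
by apply: line_uniq nqp _ _ _ _ _ _;
  rewrite ?tpoint_typ ?tline_typ ?inc_tpoint_tline.
Qed.

(** Types recover the direction of an incidence: a reverse step would put [ttype y] two successors
    after [ttype x]. Hence type-preserving automorphisms preserve directed steps. *)
Lemma triangle_step_inc x y :
  triangle_step x y = triangle_inc x y && (ttype y == ordS (ttype x)).
Proof.
rewrite /triangle_inc; have [Sxy | nSxy] := boolP (triangle_step x y).
  by case/and3P: Sxy => ->; rewrite orbT.
apply/esym/negbTE; rewrite negb_and orFb.
case: eqP => [->|_] /=; first by rewrite eq_sym ordS3_neq.
have [/and3P[/eqP-> _ _]|//] := boolP (triangle_step y x).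
by rewrite ordSS3_neq.
Qed.

Section Automorphism.

Variable g : {perm D}.
Hypothesis autg : g \in type_aut D.

Lemma aut_ttype x : ttype (g x) = ttype x.
Proof. by case/type_autP: autg => tg _; apply: tg. Qed.

Lemma aut_step x y : triangle_step (g x) (g y) = triangle_step x y.
Proof.
by case/type_autP: autg => _ ig; rewrite !triangle_step_inc !aut_ttype [X in X && _]ig.
Qed.

End Automorphism.

(** * Counting successors and predecessors *)

Definition out_nbrs x : {set D} := [set y : D | triangle_step x y].
Definition in_nbrs y : {set D} := [set x : D | triangle_step x y].

Lemma aut_out (g : {perm D}) x :
  g \in type_aut D -> out_nbrs (g x) = g @: out_nbrs x.
Proof.
move=> autg; apply/setP=> y; rewrite -[y](permKV g) mem_imset ?inE ?aut_step //.
exact: perm_inj.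
Qed.

Lemma aut_in (g : {perm D}) x :
  g \in type_aut D -> in_nbrs (g x) = g @: in_nbrs x.
Proof.
move=> autg; apply/setP=> y; rewrite -[y](permKV g) mem_imset ?inE ?aut_step //.
exact: perm_inj.
Qed.

Lemma card_aut_common_out (g : {perm D}) x y : g \in type_aut D ->
  #|out_nbrs (g x) :&: out_nbrs (g y)| = #|out_nbrs x :&: out_nbrs y|.
Proof.
by move=> autg; rewrite !aut_out // -imsetI ?card_imset //; first exact: perm_inj;
  move=> ? ? _ _; apply: perm_inj.
Qed.

Lemma card_aut_common_in (g : {perm D}) x y : g \in type_aut D ->
  #|in_nbrs (g x) :&: in_nbrs (g y)| = #|in_nbrs x :&: in_nbrs y|.
Proof.
by move=> autg; rewrite !aut_in // -imsetI ?card_imset //; first exact: perm_inj;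
  move=> ? ? _ _; apply: perm_inj.
Qed.

(** The line of a successor with point q must be the line joining [tpoint x] to q. *)
Lemma tpoint_inj_out x : {in out_nbrs x &, injective (@tpoint G)}.
Proof.
move=> y z; rewrite !inE !triangle_stepE.
move=> /and4P[/eqP ty xy _ nxy] /and4P[/eqP tz xz _ nxz] Eyz.
apply: triangle_elt_eq; rewrite // ?ty ?tz //.
by apply: line_uniq nxy _ _ _ _ _ _;
  rewrite ?tpoint_typ ?tline_typ ?inc_tpoint_tline // Eyz inc_tpoint_tline.
Qed.

(** Successors of x correspond to the points q off its line: the line of the successor joins
    [tpoint x] to q. *)
Lemma card_out x :
  #|out_nbrs x| + #|points_on (tline x)| = #|[set p : G | typ p == Point]|.
Proof.
rewrite -(card_in_imset (@tpoint_inj_out x)) addnC.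
rewrite -(cardsID (points_on (tline x)) [set p | typ p == Point]).
congr addn; apply: eq_card => p; first by rewrite !inE andbA andbb.
rewrite !inE; apply/imsetP/andP=> [[y + ->] | [+ /eqP tp]].
  rewrite inE triangle_stepE tpoint_typ eqxx /= => /and4P[_ xy nL np].
  split=> //; apply: contra_neqN nL => yL.
  by apply: line_uniq np _ _ _ _ _ _;
    rewrite ?tpoint_typ ?tline_typ ?inc_tpoint_tline.
rewrite tp eqxx /= => npL.
have nxp : tpoint x != p by apply: contraNneq npL => <-; apply: inc_tpoint_tline.
have [M [tM xM pM]] := line_through (tpoint_typ x) tp nxp.
have [y [yp yM ty]] := triangle_elt_ex (ordS (ttype x)) tp tM pM.
exists y; rewrite // inE triangle_stepE yp yM ty eqxx xM nxp andbT /=.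
by apply: contraNneq npL => ->.
Qed.

(** Thickness gives a line M through the common point other than both lines; every other point of M
    yields a common successor with line M. *)
Lemma common_out_same x y : ttype x = ttype y -> tpoint x = tpoint y ->
  exists2 M : G, typ M = Line &
    #|points_on M| <= #|out_nbrs x :&: out_nbrs y|.+1.
Proof.
move=> txy pxy; have [M [tM xM nM]] :=
  @line_avoiding _ [:: tline x; tline y] isT (tpoint_typ x).
exists M => //; rewrite (cardsD1 (tpoint x)) in_points_on tpoint_typ xM ltnS.
apply: leq_trans (leq_imset_card (@tpoint G) _); apply/subset_leq_card.
apply/subsetP=> q; rewrite in_setD1 in_points_on => /and3P[nqx /eqP tq qM].
have [z [zq zM tz]] := triangle_elt_ex (ordS (ttype x)) tq tM qM.
apply/imsetP; exists z => //; move: nM; rewrite !inE negb_or => /andP[nMx nMy].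
by rewrite !triangle_stepE zq zM tz -pxy txy eqxx xM -!(eq_sym M) nMx nMy (eq_sym (tpoint x)) nqx.
Qed.

(** A common successor has the joining line M of the two points as its line, and its point is
    neither of these two. *)
Lemma common_out_diff x y : tpoint x != tpoint y ->
  exists2 M : G, typ M = Line &
    #|out_nbrs x :&: out_nbrs y|.+2 <= #|points_on M|.
Proof.
move=> nxy; have [M [tM xM yM]] :=
  line_through (tpoint_typ x) (tpoint_typ y) nxy.
exists M => //; rewrite (cardsD1 (tpoint x)) in_points_on tpoint_typ xM ltnS.
rewrite (cardsD1 (tpoint y)) 2!inE in_points_on tpoint_typ yM eq_sym nxy ltnS.
have injC : {in out_nbrs x :&: out_nbrs y &, injective (@tpoint G)}.
  by apply: sub_in2 (@tpoint_inj_out x) => z; rewrite inE => /andP[].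
rewrite -(card_in_imset injC); apply/subset_leq_card/subsetP=> _ /imsetP[z + ->].
rewrite !inE !triangle_stepE tpoint_typ => /andP[/and4P[_ xz _ nxz] /and4P[_ yz _ nyz]].
rewrite eq_sym nyz eq_sym nxz eqxx /=.
by rewrite -(line_uniq _ _ nxy _ _ xz yz xM yM) ?tpoint_typ ?tline_typ ?inc_tpoint_tline.
Qed.

(** Dual argument: on the common line choose p avoiding both points; every other line through p
    yields a common predecessor with point p. *)
Lemma common_in_same x y : ttype x = ttype y -> tline x = tline y ->
  exists2 p : G, typ p = Point &
    #|lines_on p| <= #|in_nbrs x :&: in_nbrs y|.+1.
Proof.
move=> txy lxy; have [p [tp px np]] :=
  @point_avoiding _ [:: tpoint x; tpoint y] isT (tline_typ x).
exists p => //; rewrite (cardsD1 (tline x)) in_lines_on tline_typ px ltnS.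
apply: leq_trans (leq_imset_card (@tline G) _); apply/subset_leq_card.
apply/subsetP=> M; rewrite in_setD1 in_lines_on => /and3P[nMx /eqP tM pM].
have [z [zp zM tz]] := triangle_elt_ex (ordS (ordS (ttype x))) tp tM pM.
apply/imsetP; exists z => //; move: np; rewrite !inE negb_or => /andP[npx npy].
by rewrite !triangle_stepE zp zM tz -lxy -txy ordSSS3 eqxx px nMx npx npy.
Qed.

(** A common predecessor has the meeting point of the two lines as its point, and its line is
    neither of them. *)
Lemma common_in_diff x y : tline x != tline y ->
  exists2 p : G, typ p = Point &
    #|in_nbrs x :&: in_nbrs y|.+2 <= #|lines_on p|.
Proof.
move=> nxy; have [C0 | [z0 Cz0]] := set_0Vmem (in_nbrs x :&: in_nbrs y).
  (* The lines may fail to meet; then any point serves, since it lies on at least three lines. *)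
  exists (tpoint x); first exact: tpoint_typ.
  have [_ /(_ _ (tpoint_typ x)) r3] := thickG.
  by rewrite C0 cards0 (leq_trans _ r3).
have tpC z : z \in in_nbrs x :&: in_nbrs y -> tpoint z = tpoint z0.
  move: Cz0; rewrite !inE !triangle_stepE.
  move=> /andP[/and4P[_ z0x _ _] /and4P[_ z0y _ _]].
  move=> /andP[/and4P[_ zx _ _] /and4P[_ zy _ _]].
  apply: contra_neq_eq nxy => nz.
  by apply: line_uniq nz _ _ _ _ _ _; rewrite ?tpoint_typ ?tline_typ.
have injC : {in in_nbrs x :&: in_nbrs y &, injective (@tline G)}.
  move=> z w Cz Cw Ezw; apply: triangle_elt_eq; rewrite ?tpC //.
  apply: ordS_inj; move: Cz Cw; rewrite !inE !triangle_stepE.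
  by move=> /andP[/and4P[/eqP<- _ _ _] _] /andP[/and4P[/eqP<- _ _ _] _].
exists (tpoint z0); first exact: tpoint_typ.
have [z0x z0y] : inc (tpoint z0) (tline x) /\ inc (tpoint z0) (tline y).
  by move: Cz0; rewrite !inE !triangle_stepE => /andP[/and4P[_ -> _ _] /and4P[_ -> _ _]].
rewrite (cardsD1 (tline x)) in_lines_on tline_typ z0x ltnS.
rewrite (cardsD1 (tline y)) 2!inE in_lines_on tline_typ z0y eq_sym nxy ltnS.
rewrite -(card_in_imset injC); apply/subset_leq_card/subsetP=> _ /imsetP[z Cz ->].
rewrite !inE -(tpC _ Cz) inc_tpoint_tline tline_typ eqxx andbT.
by move: Cz; rewrite !inE !triangle_stepE => /andP[/and4P[_ _ -> _] /and4P[_ _ -> _]].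
Qed.


(** * From automorphisms of the complex to automorphisms of the linear space *)

Section Homogeneous.

(** The form in which flag-transitivity enters this section; [flag_transitive_homogeneous] supplies
    it. *)
Hypothesis homogD : forall x y, ttype x = ttype y ->
  exists2 g : {perm D}, g \in type_aut D & g x = y.

Lemma line_elt_ex L i : typ L = Line ->
  exists x, tline x = L /\ ttype x = i.
Proof.
move=> tL; have [p [tp pL _]] := @point_avoiding L [::] isT tL.
by have [x [_ xL tx]] := triangle_elt_ex i tp tL pL; exists x.
Qed.

Lemma point_elt_ex p i : typ p = Point ->
  exists x, tpoint x = p /\ ttype x = i.
Proof.
move=> tp; have [L [tL pL _]] := @line_avoiding p [::] isT tp.
by have [x [xp _ tx]] := triangle_elt_ex i tp tL pL; exists x.
Qed.

Lemma card_points_on_const L M : typ L = Line -> typ M = Line ->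
  #|points_on L| = #|points_on M|.
Proof.
move=> /(line_elt_ex ord0)[x [<- tx]] /(line_elt_ex ord0)[y [<- ty]].
have [|g autg <-] := @homogD x y; first by rewrite tx.
apply: (@addnI #|out_nbrs x|); rewrite card_out -(card_out (g x)).
by rewrite aut_out // card_imset //; apply: perm_inj.
Qed.

Lemma aut_same_point (g : {perm D}) x y : g \in type_aut D ->
  ttype x = ttype y -> tpoint x = tpoint y -> tpoint (g x) = tpoint (g y).
Proof.
move=> autg txy pxy; apply/eqP/negPn/negP => /common_out_diff[M tM].
rewrite card_aut_common_out // => ltM.
have [L tL] := common_out_same txy pxy.
by rewrite leqNgt (card_points_on_const tL tM) ltM.
Qed.

(* The elements of a given type and point correspond to the lines through the
   point, and an automorphism maps such a class into another one. *)
Lemma leq_card_lines_on p q : typ p = Point -> typ q = Point ->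
  #|lines_on p| <= #|lines_on q|.
Proof.
move=> /(point_elt_ex ord0)[x [<- tx]] /(point_elt_ex ord0)[y [<- ty]].
have [|g autg <-] := @homogD x y; first by rewrite tx.
pose S z := [set w : D | (ttype w == ttype z) && (tpoint w == tpoint z)].
have cardS z : #|S z| = #|lines_on (tpoint z)|.
  have injS : {in S z &, injective (@tline G)}.
    move=> v w; rewrite !inE => /andP[/eqP tv /eqP pv] /andP[/eqP tw /eqP pw] Evw.
    by apply: triangle_elt_eq; rewrite ?tv ?pv.
  rewrite -(card_in_imset injS); apply: eq_card => L; rewrite in_lines_on.
  apply/imsetP/andP => [[w + ->] | [/eqP tL zL]].
    by rewrite inE tline_typ => /andP[_ /eqP <-]; rewrite inc_tpoint_tline.
  have [w [wz wL tw]] := triangle_elt_ex (ttype z) (tpoint_typ z) tL zL.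
  by exists w; rewrite // inE wz tw !eqxx.
rewrite -!cardS -(card_imset _ (@perm_inj _ g)); apply/subset_leq_card.
apply/subsetP=> _ /imsetP[w + ->]; rewrite !inE !aut_ttype //.
move=> /andP[/eqP tw /eqP pw]; rewrite tw eqxx; exact/eqP/aut_same_point.
Qed.

Lemma aut_same_line (g : {perm D}) x y : g \in type_aut D ->
  ttype x = ttype y -> tline x = tline y -> tline (g x) = tline (g y).
Proof.
move=> autg txy lxy; apply/eqP/negPn/negP => /common_in_diff[p tp].
rewrite card_aut_common_in // => ltp.
have [q tq] := common_in_same txy lxy.
by rewrite leqNgt (leq_trans ltp) ?leq_card_lines_on.
Qed.

Lemma aut_same_pointE (g : {perm D}) x y : g \in type_aut D ->
  ttype x = ttype y -> (tpoint (g x) == tpoint (g y)) = (tpoint x == tpoint y).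
Proof.
move=> autg txy; apply/eqP/eqP => [E|]; last exact: aut_same_point.
rewrite -[x](permK g) -[y](permK g).
by apply: aut_same_point E; rewrite ?groupV ?aut_ttype.
Qed.

Lemma aut_same_lineE (g : {perm D}) x y : g \in type_aut D ->
  ttype x = ttype y -> (tline (g x) == tline (g y)) = (tline x == tline y).
Proof.
move=> autg txy; apply/eqP/eqP => [E|]; last exact: aut_same_line.
rewrite -[x](permK g) -[y](permK g).
by apply: aut_same_line E; rewrite ?groupV ?aut_ttype.
Qed.

(* With M the common line, a point p of M and a line L <> M through p, the element
   (p, L, i) has a neighbour (q, M, i + 1), so the image of p lies on the image of
   M computed in type i + 1 as well as on the one computed in type i; two choices
   of p identify these images. *)
Lemma aut_line_ordS (g : {perm D}) x y : g \in type_aut D ->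
  ttype y = ordS (ttype x) -> tline x = tline y -> tline (g x) = tline (g y).
Proof.
move=> autg ty lxy; set M := tline x.
suff onM p : typ p = Point -> inc p M -> exists z,
    [/\ ttype z = ttype x, tpoint z = p,
        inc (tpoint (g z)) (tline (g x)) & inc (tpoint (g z)) (tline (g y))].
  have [q [tq qM]] := @point_avoiding _ [:: tpoint x] isT (tline_typ x).
  rewrite inE => nqx.
  have [z [tz zx zgx zgy]] := onM _ (tpoint_typ x) (inc_tpoint_tline x).
  have [w [tw wq wgx wgy]] := onM _ tq qM.
  have nzw : tpoint (g z) != tpoint (g w).
    by rewrite aut_same_pointE ?tz ?tw // zx wq eq_sym.
  by apply: (line_uniq _ _ nzw); rewrite ?tpoint_typ ?tline_typ.
move=> tp pM; have [L [tL pL]] := @line_avoiding p [:: M] isT tp.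
rewrite inE => nLM.
have [q [tq qM]] := @point_avoiding M [:: p] isT (tline_typ x).
rewrite inE => nqp.
have [z [zp zL tz]] := triangle_elt_ex (ttype x) tp tL pL.
have [v [vp vM tv]] := triangle_elt_ex (ttype x) tp (tline_typ x) pM.
have [w [wq wM tw]] := triangle_elt_ex (ttype y) tq (tline_typ x) qM.
exists z; split=> //.
  have -> : tpoint (g z) = tpoint (g v) by apply: aut_same_point; rewrite ?tz ?zp.
  have -> : tline (g x) = tline (g v) by apply: aut_same_line; rewrite ?tv ?vM.
  exact: inc_tpoint_tline.
have -> : tline (g y) = tline (g w) by apply: aut_same_line; rewrite ?tw ?wM -?lxy.
have : triangle_step z w.
  by rewrite triangle_stepE tw ty tz eqxx zp wM pM zL nLM wq eq_sym nqp.
by rewrite -(aut_step autg) triangle_stepE => /and4P[].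
Qed.

Lemma aut_line (g : {perm D}) x y : g \in type_aut D ->
  tline x = tline y -> tline (g x) = tline (g y).
Proof.
move=> autg lxy.
(* Representatives of the same line in the other two types let [aut_line_ordS] be chained around the
   cycle. *)
have [z [zL tz]] := line_elt_ex (ordS (ttype x)) (tline_typ x).
have [w [wL tw]] := line_elt_ex (ordS (ordS (ttype x))) (tline_typ x).
have Ez : tline (g x) = tline (g z) by apply: aut_line_ordS.
have Ew : tline (g z) = tline (g w) by apply: aut_line_ordS; rewrite ?tz ?zL.
have [E|E|E] := ord3_cases (ttype x) (ttype y).
- exact: aut_same_line.
- by rewrite Ez; apply: aut_same_line; rewrite ?E ?zL.
- by rewrite Ez Ew; apply: aut_same_line; rewrite ?E ?wL.
Qed.

(** Take a second line M through p. By [aut_line] the images of both lines are independent of the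
    type, and they differ. The points of [g x] and [g y] lie on both images, hence agree. *)
Lemma aut_point (g : {perm D}) x y : g \in type_aut D ->
  tpoint x = tpoint y -> tpoint (g x) = tpoint (g y).
Proof.
move=> autg pxy; set p := tpoint x.
have [M [tM pM]] := @line_avoiding p [:: tline x] isT (tpoint_typ x).
rewrite inE => nMx.
have [xM [xMp xMM txM]] := triangle_elt_ex (ttype x) (tpoint_typ x) tM pM.
have [yM [yMp yMM tyM]] := triangle_elt_ex (ttype y) (tpoint_typ x) tM pM.
have [yL [yLp yLL tyL]] :=
  triangle_elt_ex (ttype y) (tpoint_typ x) (tline_typ x) (inc_tpoint_tline x).
have -> : tpoint (g y) = tpoint (g yL).
  by apply: aut_same_point; rewrite ?tyL ?yLp.
have ExM : tpoint (g x) = tpoint (g xM).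
  by apply: aut_same_point; rewrite ?txM ?xMp.
have EyM : tpoint (g yL) = tpoint (g yM).
  by apply: aut_same_point; rewrite ?tyL ?tyM ?yLp ?yMp.
have nL : tline (g x) != tline (g xM).
  by rewrite aut_same_lineE ?txM // xMM eq_sym.
apply: contra_neq_eq nL => npq.
have lL : tline (g yL) = tline (g x) by apply: aut_line.
have lM : tline (g yM) = tline (g xM) by apply: aut_line; rewrite ?xMM.
apply: (line_uniq _ _ npq); rewrite ?tpoint_typ ?tline_typ ?inc_tpoint_tline //.
- by rewrite -lL inc_tpoint_tline.
- by rewrite ExM inc_tpoint_tline.
- by rewrite EyM -lM inc_tpoint_tline.
Qed.

(* The action of [g] on points and lines, read off on an arbitrary element; the
   last default is junk, every [v] being a point or a line of some element. *)
Definition induced_map (g : {perm D}) (v : G) : G :=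
  if [pick x : D | tpoint x == v] is Some x then tpoint (g x)
  else if [pick x : D | tline x == v] is Some x then tline (g x) else v.

Lemma induced_map_point (g : {perm D}) x : g \in type_aut D ->
  induced_map g (tpoint x) = tpoint (g x).
Proof.
move=> autg; rewrite /induced_map; case: pickP => [y /eqP | /(_ x)].
  exact: aut_point.
by rewrite eqxx.
Qed.

Lemma induced_map_line (g : {perm D}) x : g \in type_aut D ->
  induced_map g (tline x) = tline (g x).
Proof.
move=> autg; rewrite /induced_map; case: pickP => [y /eqP E | _].
  by have := tpoint_typ y; rewrite E tline_typ.
case: pickP => [y /eqP | /(_ x)]; first exact: aut_line.
by rewrite eqxx.
Qed.

Lemma point_or_line (v : G) :
  (exists x, v = tpoint x) \/ (exists x, v = tline x).
Proof.
case tv: (typ v); [left | right].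
  by have [x [<- _]] := point_elt_ex ord0 tv; exists x.
by have [x [<- _]] := line_elt_ex ord0 tv; exists x.
Qed.

Lemma induced_map_typ (g : {perm D}) v : g \in type_aut D ->
  typ (induced_map g v) = typ v.
Proof.
move=> autg; have [[x ->]|[x ->]] := point_or_line v.
  by rewrite induced_map_point ?tpoint_typ.
by rewrite induced_map_line ?tline_typ.
Qed.

Lemma induced_mapK (g : {perm D}) : g \in type_aut D ->
  cancel (induced_map g) (induced_map g^-1).
Proof.
move=> autg v; have [[x ->]|[x ->]] := point_or_line v.
  by rewrite !induced_map_point ?groupV ?permK.
by rewrite !induced_map_line ?groupV ?permK.
Qed.

Lemma induced_map_inc (g : {perm D}) u v : g \in type_aut D ->
  inc u v -> inc (induced_map g u) (induced_map g v).
Proof.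
move=> autg uv.
have [/(inc_typ uv)-> | ] := eqVneq (typ u) (typ v); first exact: inc_refl.
wlog tu : u v uv / typ u = Point.
  move=> IH ntuv; case tu: (typ u); first exact: IH.
  rewrite inc_sym; apply: IH; rewrite 1?inc_sym 1?eq_sym //.
  by move: ntuv; rewrite tu; case: (typ v).
rewrite tu; case tv: (typ v) => // _.
have [x [<- <- _]] := triangle_elt_ex ord0 tu tv uv.
by rewrite induced_map_point // induced_map_line // inc_tpoint_tline.
Qed.

(** Only the effect on points is recorded, since the triples to be moved consist of points. *)
Lemma aut_complex_induced (g : {perm D}) : g \in type_aut D ->
  exists2 h : {perm G}, h \in type_aut G &
    forall x, tpoint (g x) = h (tpoint x).
Proof.
move=> autg; exists (perm (can_inj (induced_mapK autg))); last first.
  by move=> x; rewrite permE induced_map_point.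
apply/type_autP; split=> [v|u v]; rewrite !permE ?induced_map_typ //.
apply/idP/idP; last exact: induced_map_inc.
have autgV : (g^-1)%g \in type_aut D by rewrite groupV.
by move/(induced_map_inc autgV); rewrite !induced_mapK.
Qed.

End Homogeneous.

(** * From automorphisms of the linear space to automorphisms of the complex *)

Lemma complex_aut_of_aut (h : {perm G}) : h \in type_aut G ->
  exists2 g : {perm D}, g \in type_aut D &
    forall x, tpoint (g x) = h (tpoint x).
Proof.
case/type_autP=> th ih.
have /fin_all_exists[f fP] (x : D) : exists y : D,
    [/\ tpoint y = h (tpoint x), tline y = h (tline x) & ttype y = ttype x].
  apply: triangle_elt_ex; rewrite ?th ?ih ?tpoint_typ ?tline_typ //.
  exact: inc_tpoint_tline.
have inj_f : injective f.
  move=> x y Efxy; have [px lx tx] := fP x; have [py ly ty] := fP y.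
  apply: triangle_elt_eq; first by apply: (@perm_inj _ h); rewrite -px -py Efxy.
    by apply: (@perm_inj _ h); rewrite -lx -ly Efxy.
  by rewrite -tx -ty Efxy.
(* By [triangle_stepE] a step is a matter of types, incidence and equality, all of which [f]
   respects. *)
have step_f x y : triangle_step (f x) (f y) = triangle_step x y.
  have [px lx tx] := fP x; have [py ly ty] := fP y.
  by rewrite !triangle_stepE px py lx ly tx ty ih !(inj_eq perm_inj).
exists (perm inj_f) => [|x]; last by rewrite permE; case: (fP x).
apply/type_autP; split=> [x|x y]; rewrite !permE; first by case: (fP x).
by rewrite /= /triangle_inc !step_f (inj_eq inj_f).
Qed.

(** * Chambers, triangles and non-collinear triples *)

(** The vertices are the points of the [e i]; the line of [e (ordS i)] is the side joining vertices
    i and i + 1. *)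
Definition triangle (e : 'I_3 -> triangle_elt G) :=
  (forall i, ttype (e i) = i) /\ (forall i, triangle_step (e i) (e (ordS i))).

(** A flag has at most one element of each type, and the three cyclic steps account for all pairs of
    distinct types. *)
Lemma chamberP (C : {set D}) :
  chamber C <-> exists2 e, triangle e & C = [set e i | i : 'I_3].
Proof.
split=> [/andP[/'forall_in_forall_inP incC /forallP/= tyC] | [e [te se] ->]].
  have /fin_all_exists[e eP] i : exists x : D, x \in C /\ ttype x = i.
    by have /exists_inP[x Cx /eqP tx] := tyC i; exists x.
  have [Ce te] : (forall i, e i \in C) /\ (forall i, ttype (e i) = i).
    by split=> i; case: (eP i).
  exists e; first split=> // i.
    by rewrite triangle_step_inc !te eqxx andbT; apply: incC.
  apply/setP=> x; apply/idP/imsetP=> [Cx | [i _ ->] //].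
  exists (ttype x) => //; apply: (@inc_typ _ D); first exact: incC.
  by rewrite /= te.
apply/andP; split; last first.
  apply/forallP=> i; apply/exists_inP; exists (e i); first exact: imset_f.
  by rewrite /= te.
apply/'forall_in_forall_inP => _ /imsetP[i _ ->] _ /imsetP[j _ ->].
rewrite /= /triangle_inc; have [->|->|->] := ord3_cases i j.
- by rewrite eqxx.
- by rewrite se orbT.
- by have := se (ordS (ordS i)); rewrite ordSSS3 => ->; rewrite !orbT.
Qed.

Lemma noncollinear_triplesP (t : 3.-tuple G) :
  reflect ((forall i, typ (tnth t i) = Point) /\
           forall L, typ L = Line -> ~ forall i, inc (tnth t i) L)
          (t \in noncollinear_triples G).
Proof.
rewrite inE; apply: (iffP andP) => [[/forallP tt ncol] | [tt ncol]].
  split=> [i|L tL tLi]; first exact/eqP/tt.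
  by case/existsP: ncol; exists L; rewrite tL eqxx; apply/forallP.
split; first by apply/forallP=> i; rewrite tt.
by apply/existsP=> -[L /andP[/eqP tL /forallP]]; apply: ncol.
Qed.

(** If one line contained all vertices, every side would equal it, but consecutive sides differ. *)
Lemma triangle_noncollinear e : triangle e ->
  [tuple tpoint (e i) | i < 3] \in noncollinear_triples G.
Proof.
case=> te se; apply/noncollinear_triplesP; split=> [i|L tL colL].
  by rewrite tnth_mktuple tpoint_typ.
have onL i : inc (tpoint (e i)) L by have := colL i; rewrite tnth_mktuple.
have eqL i : tline (e (ordS i)) = L.
  have := se i; rewrite triangle_stepE => /and4P[_ iS _ nii].
  by apply: (line_uniq _ _ nii);
    rewrite ?tpoint_typ ?tline_typ ?inc_tpoint_tline.
have := se (ordS ord0); rewrite triangle_stepE => /and4P[_ _ + _].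
by rewrite !eqL eqxx.
Qed.

Lemma noncollinear_triangle t : t \in noncollinear_triples G ->
  exists2 e, triangle e & forall i, tpoint (e i) = tnth t i.
Proof.
case/noncollinear_triplesP=> tt ncol.
have col_at i L : typ L = Line -> inc (tnth t i) L ->
    inc (tnth t (ordS i)) L -> ~ inc (tnth t (ordS (ordS i))) L.
  by move=> tL ? ? ?; apply: (ncol L tL) => j; have [->|->|->] := ord3_cases i j.
(* A repeated point would leave at most two distinct points, which some line contains. *)
have neq i : tnth t i != tnth t (ordS i).
  apply/eqP=> Ei; have [ESS | nSS] := eqVneq (tnth t i) (tnth t (ordS (ordS i))).
    have [L [tL iL _]] := @line_avoiding _ [::] isT (tt i).
    by apply: (@col_at i L); rewrite -?ESS -?Ei.
  have [L [tL iL SSL]] := line_through (tt i) (tt (ordS (ordS i))) nSS.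
  by apply: (@col_at i L); rewrite -?Ei.
(* The line of [e i] is the side joining vertex i to its cyclic predecessor, which is
   [ordS (ordS i)]. *)
have /fin_all_exists[e eP] i : exists x : triangle_elt G,
    [/\ ttype x = i, tpoint x = tnth t i & inc (tnth t (ordS (ordS i))) (tline x)].
  have ni := neq (ordS (ordS i)); rewrite ordSSS3 in ni.
  have [L [tL SSL iL]] := line_through (tt _) (tt _) ni.
  by have [x [xi xL tx]] := triangle_elt_ex i (tt i) tL iL; exists x; rewrite xL.
exists e => [|i]; last by case: (eP i).
split=> i; first by case: (eP i).
have [ti pi li] := eP i; have [tSi pSi lSi] := eP (ordS i).
rewrite ordSSS3 in lSi.
rewrite triangle_stepE ti tSi pi pSi eqxx lSi neq andbT /=.
apply/eqP=> El; apply: (@col_at i (tline (e i))); rewrite ?tline_typ //.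
  by rewrite El.
by rewrite El -pSi inc_tpoint_tline.
Qed.

(** Each side joins two distinct vertices, so the vertices determine the lines. Writing i as the
    successor of j exhibits the line at i as the side from j to i. *)
Lemma triangle_inj e1 e2 : triangle e1 -> triangle e2 ->
  (forall i, tpoint (e1 i) = tpoint (e2 i)) -> e1 =1 e2.
Proof.
move=> [t1 s1] [t2 s2] Ep i; rewrite -[i]ordSSS3.
set j := ordS (ordS i).
apply: triangle_elt_eq; rewrite ?t1 ?t2 //.
have:= s1 j; rewrite triangle_stepE => /and4P[_ jS _ njj].
have:= s2 j; rewrite triangle_stepE => /and4P[_ jS2 _ _].
apply: (line_uniq _ _ njj); rewrite ?tpoint_typ ?tline_typ ?inc_tpoint_tline //.
  by rewrite Ep.
by rewrite Ep inc_tpoint_tline.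
Qed.

Lemma triangle_aut (g : {perm D}) e : g \in type_aut D ->
  triangle e -> triangle (fun i => g (e i)).
Proof.
by move=> autg [te se]; split=> i; rewrite ?aut_ttype // aut_step.
Qed.

Lemma chamber_act (g : {perm D}) e :
  ('P^*)%act [set e i | i : 'I_3] g = [set g (e i) | i : 'I_3].
Proof. by rewrite /= /setact -imset_comp. Qed.

Lemma triple_act (h : {perm G}) (t : 3.-tuple G) i :
  tnth (('P * 3)%act t h) i = h (tnth t i).
Proof. by rewrite tnth_map. Qed.

(** * The two implications between the transitivity properties *)

Lemma flag_transitive_of_transitive :
  [transitive type_aut G, on noncollinear_triples G | 'P * 3] ->
  flag_transitive D.
Proof.
move=> trT; have /imsetP[t0 Tt0 _] := trT.
have [e0 e0_tri pe0] := noncollinear_triangle Tt0.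
apply: (@atransI _ _ _ _ _ [set e0 i | i : 'I_3]).
- by rewrite inE; apply/chamberP; exists e0.
- move=> g autg; rewrite /= chamber_act inE; apply/chamberP.
  by exists (fun i => g (e0 i)) => //; apply: triangle_aut.
move=> C; rewrite inE => /chamberP[e e_tri ->].
have [h auth Eh] := atransP2 trT Tt0 (triangle_noncollinear e_tri).
have [g autg Eg] := complex_aut_of_aut auth.
(* The moved triangle and the target have the same vertices, so [triangle_inj] identifies them. *)
exists g; rewrite //= chamber_act; apply: eq_imset; apply: triangle_inj => //.
  exact: triangle_aut.
by move=> i; rewrite Eg pe0 -triple_act -Eh tnth_mktuple.
Qed.

(** Every element lies in a maximal flag, hence in a chamber. If g maps a chamber of x to one of y,
    then [g x] and y are elements of equal type in one flag. *)
Lemma flag_transitive_homogeneous : geometry D -> flag_transitive D ->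
  forall x y, ttype x = ttype y ->
  exists2 g : {perm D}, g \in type_aut D & g x = y.
Proof.
move=> geomD trD x y txy.
have extend (z : D) : exists2 C, C \in [set C | chamber C] & z \in C.
  have flz : flag [set z].
    by apply/'forall_in_forall_inP => u /set1P-> v /set1P->; apply: inc_refl.
  have [C maxC] := maxset_exists flz; rewrite sub1set => Cz.
  by exists C; rewrite // inE geomD.
have [C chC Cx] := extend x; have [C' chC' C'y] := extend y.
have [g autg EC'] := atransP2 trD chC chC'.
exists g => //; apply: (@inc_typ _ D); last by rewrite /= aut_ttype.
move: chC'; rewrite inE => /andP[/'forall_in_forall_inP incC' _].
by apply: incC' => //; rewrite EC'; apply: mem_setact.
Qed.

Lemma transitive_of_flag_transitive : geometry D -> flag_transitive D ->
  [transitive type_aut G, on noncollinear_triples G | 'P * 3].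
Proof.
move=> geomD trD; have homogD := flag_transitive_homogeneous geomD trD.
have /imsetP[C0 + _] := trD; rewrite inE => chC0.
have /chamberP[e0 e0_tri EC0] := chC0.
apply: (@atransI _ _ _ _ _ [tuple tpoint (e0 i) | i < 3]).
- exact: triangle_noncollinear.
(* Non-collinearity of the image triple is read off the complex: the lift g of h maps triangles to
   triangles. *)
- move=> h auth; have [g autg Eg] := complex_aut_of_aut auth.
  have -> : ('P * 3)%act [tuple tpoint (e0 i) | i < 3] h
      = [tuple tpoint (g (e0 i)) | i < 3].
    by apply: eq_from_tnth => i; rewrite triple_act !tnth_mktuple Eg.
  exact/triangle_noncollinear/triangle_aut.
move=> t /noncollinear_triangle[e e_tri pe].
have [] := atransP2 trD (x := C0) (y := [set e i | i : 'I_3]).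
- by rewrite inE.
- by rewrite inE; apply/chamberP; exists e.
move=> g autg; rewrite EC0 /= chamber_act => EC.
have [h auth Eh] := aut_complex_induced homogD autg.
exists h => //; apply: eq_from_tnth => i; rewrite triple_act tnth_mktuple -Eh -pe.
(* The chambers agree only as sets; comparing types matches [e i] with [g (e0 i)]. *)
have /imsetP[j _ Ej] : e i \in [set g (e0 j) | j : 'I_3] by rewrite -EC imset_f.
have [[te0 _] [te _]] := (e0_tri, e_tri).
have Eij : i = j by rewrite -[i]te Ej aut_ttype ?te0.
by rewrite [in RHS]Eij -Ej.
Qed.

End ThickLinearSpace.

Theorem theorem3p10 (G : incidence_system pl_type)
    (linG : linear_space G) (thickG : thick G)
    (geomT : geometry (triangle_complex G)) :
  flag_transitive (triangle_complex G) <->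
  [transitive type_aut G, on noncollinear_triples G | 'P * 3].
Proof.
split; first exact: transitive_of_flag_transitive.
exact: flag_transitive_of_transitive.
Qed.
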